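(* There exists a digraph $D$ with the following properties: (i) $D$ contains infinitely many pairwise disjoint rays. (ii) $D$ contains infinitely many pairwise disjoint anti-rays. (iii) Every ray and every anti-ray of $D$ share a vertex.
   Context: A ray is a weakly connected digraph in which each vertex has in- and out-degree $1$ except one vertex (its starting vertex) which has in-degree $0$ and out-degree $1$; an anti-ray is the same with in- and out-degree interchanged. Rays and anti-rays of $D$ are subdigraphs of $D$. Disjoint means vertex-disjoint. *)

(* Defs.v *)
From Stdlib Require Import Relations.
From mathcomp Require Import all_boot.
From mathcomp Require Import boolp classical_sets functions cardinality.

Set Implicit Arguments.
Unset Strict Implicit.
Unset Printing Implicit Defensive.

Local Open Scope classical_set_scope.
Local Open Scope card_scope.

(* Digraphs of arbitrary cardinality, without loops or parallel arcs (opposite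
   arcs between two vertices are allowed). The vertices are a subset of an
   ambient type, so that subdigraphs of a digraph are again digraphs. *)
Record digraph (U : Type) := Digraph {
  vertices : set U;
  arc : U -> U -> Prop;
  arc_source : forall u v, arc u v -> vertices u;
  arc_target : forall u v, arc u v -> vertices v;
  arc_loopless : forall u, ~ arc u u }.

Definition subdigraph (U : Type) (H D : digraph U) : Prop :=
  vertices H `<=` vertices D /\ (forall u v, arc H u v -> arc D u v).

Definition has_in_degree (U : Type) (D : digraph U) (v : U) (n : nat) : Prop :=
  [set u | arc D u v] #= `I_n.

Definition has_out_degree (U : Type) (D : digraph U) (v : U) (n : nat) : Prop :=
  [set w | arc D v w] #= `I_n.

Definition weakly_connected (U : Type) (D : digraph U) : Prop :=
  vertices D !=set0 /\
  forall u v, vertices D u -> vertices D v -> clos_refl_sym_trans U (arc D) u v.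

Definition is_ray (U : Type) (R : digraph U) : Prop :=
  weakly_connected R /\
  exists s, [/\ vertices R s,
                has_in_degree R s 0,
                has_out_degree R s 1 &
                forall v, vertices R v -> v <> s ->
                  has_in_degree R v 1 /\ has_out_degree R v 1].

Definition is_antiray (U : Type) (A : digraph U) : Prop :=
  weakly_connected A /\
  exists s, [/\ vertices A s,
                has_out_degree A s 0,
                has_in_degree A s 1 &
                forall v, vertices A v -> v <> s ->
                  has_out_degree A v 1 /\ has_in_degree A v 1].

Definition ray_of (U : Type) (D R : digraph U) : Prop :=
  subdigraph R D /\ is_ray R.

Definition antiray_of (U : Type) (D A : digraph U) : Prop :=
  subdigraph A D /\ is_antiray A.

Definition infinitely_many_disjoint (U : Type) (P : digraph U -> Prop) : Prop :=
  exists F : set (digraph U),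
    [/\ infinite_set F, (forall H, F H -> P H) & trivIset F (@vertices U)].

(* Main.v *)
(* Chain together finite square grids of increasing size, so that the rows of
   each square continue as rows of the next one, while the columns of each
   square continue, directed backwards, as columns of the next one. The rows
   give infinitely many disjoint rays and the columns infinitely many disjoint
   anti-rays. Any ray leaves every finite union of squares; before it first goes
   beyond the N-th square, with N large, it must cross that square from left to
   right. Likewise any anti-ray crosses the N-th square vertically, and two such
   monotone crossings of a square meet. *)
Require Import Defs.
From Stdlib Require Import Relations.
From mathcomp Require Import all_boot.
From mathcomp Require Import boolp classical_sets functions cardinality.
From mathcomp Require Import zify.
(* Restores [Defs.arc], shadowed by [path.arc]. *)
Import Defs.

Set Implicit Arguments.
Unset Strict Implicit.
Unset Printing Implicit Defensive.

Local Open Scope classical_set_scope.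

(** * Degrees zero and one *)

Lemma card_eq_II0 (T : Type) (A : set T) : (A #= `I_0)%card <-> A = set0.
Proof.
split=> [|->]; last by rewrite II0.
by rewrite II0 card_eq0 => /eqP.
Qed.

Lemma card_eq_II1 (T : Type) (A : set T) :
  (A #= `I_1)%card <-> exists a, A = [set a].
Proof.
rewrite II1; split=> [|[a ->]]; last exact: eq_card1.
move=> /card_set_bijP[f [f_fun f_inj f_surj]].
have [a Aa fa0] := f_surj 0 erefl.
exists a; apply/seteqP; split=> [b Ab /=|b ->//].
have fA c : A c -> f c = 0 by move=> /f_fun.
by apply: f_inj; rewrite ?inE// !fA.
Qed.

(** * Rays and injective sequences of vertices *)

Section Digraphs.
Variable U : Type.
Implicit Types (D H : digraph U) (p : nat -> U).

Definition rev_digraph D : digraph U :=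
  @Digraph U (vertices D) (fun u v => arc D v u)
    (fun u v uv => arc_target uv) (fun u v uv => arc_source uv)
    (@arc_loopless U D).

Lemma weakly_connected_rev D :
  weakly_connected D -> weakly_connected (rev_digraph D).
Proof.
move=> [D0 Dconn]; split=> // u v Du Dv.
elim: (Dconn u v Du Dv) => {u v Du Dv} [u v uv|u|u v _|u v w _ uv _ vw].
- by apply: rst_sym; apply: rst_step.
- exact: rst_refl.
- exact: rst_sym.
- exact: rst_trans uv vw.
Qed.

Lemma is_antiray_rev D : is_ray D -> is_antiray (rev_digraph D).
Proof. by move=> [Dconn Ddeg]; split=> //; exact: weakly_connected_rev. Qed.

Lemma is_ray_rev D : is_antiray D -> is_ray (rev_digraph D).
Proof. by move=> [Dconn Ddeg]; split=> //; exact: weakly_connected_rev. Qed.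

(** Follow out-arcs from the starting vertex. In-neighbours are unique, so a repeated vertex could
    be traced back until the start gets an in-neighbour. *)
Lemma ray_sequence H : is_ray H ->
  exists p, [/\ injective p, (forall k, vertices H (p k)) &
                forall k, arc H (p k) (p k.+1)].
Proof.
move=> [_ [s [Hs /card_eq_II0 s_in s_out Hdeg]]].
have out v : vertices H v -> exists w, arc H v w.
  move=> Hv; have /card_eq_II1[w vw] : has_out_degree H v 1.
    by have [->//|/(Hdeg v Hv)[]] := pselect (v = s).
  by exists w; rewrite -[arc H v w]/([set w | arc H v w] w) vw.
have s_no_in u : ~ arc H u s.
  by move=> us; have : [set u | arc H u s] u; rewrite // s_in.
have in_inj u u' v : arc H u v -> arc H u' v -> u = u'.
  move=> uv u'v; have vs : v <> s.
    by move=> vs; apply: (s_no_in u); rewrite -vs.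
  have [/card_eq_II1[w vw] _] := Hdeg v (arc_target uv) vs.
  have inE z : arc H z v -> z = w.
    by move=> zv; apply: (_ : [set w] z); rewrite -vw.
  by rewrite (inE u)// (inE u').
have [f fP] : {f : U -> U & forall v, vertices H v -> arc H v (f v)}.
  apply: (choice (P := fun v w => vertices H v -> arc H v w)) => v.
  have [/out[w vw]|nHv] := pselect (vertices H v).
    by exists w.
  by exists v.
pose p k := iter k f s.
have Hp k : vertices H (p k) by elim: k => //= k Hpk; exact: arc_target (fP _ Hpk).
have pP k : arc H (p k) (p k.+1) by apply: fP.
have p_neq_s k : p k.+1 <> s.
  by move=> pks; apply: (s_no_in (p k)); rewrite -pks.
exists p; split=> //; elim=> [|i IH] [|j]//.
- by move=> /esym /p_neq_s.
- by move=> /p_neq_s.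
- move=> pij; congr _.+1; apply: IH.
  by apply: in_inj (pP i) _; rewrite pij.
Qed.

Section Sequence.
Variables (p : nat -> U) (p_inj : injective p).

Lemma sequence_loopless u : ~ exists2 k, u = p k & u = p k.+1.
Proof. by move=> [k -> /p_inj]; lia. Qed.

Definition sequence_digraph : digraph U.
Proof.
refine (@Digraph U (range p) (fun u v => exists2 k, u = p k & v = p k.+1)
  _ _ sequence_loopless) => u v [k uk vk].
- by exists k.
- by exists k.+1.
Defined.

Lemma sequence_is_ray : is_ray sequence_digraph.
Proof.
have out1 k : has_out_degree sequence_digraph (p k) 1.
  apply/card_eq_II1; exists (p k.+1); apply/seteqP; split=> w /=.
    by move=> [l /p_inj -> ->].
  by move=> ->; exists k.
split.
  split; first by exists (p 0), 0.
  have conn0 k : clos_refl_sym_trans U (arc sequence_digraph) (p 0) (p k).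
    elim: k => [|k IH]; first exact: rst_refl.
    by apply: rst_trans IH _; apply: rst_step; exists k.
  move=> _ _ [k _ <-] [l _ <-].
  exact: rst_trans (rst_sym _ _ _ _ (conn0 k)) (conn0 l).
exists (p 0); split=> //; first by exists 0.
  apply/card_eq_II0/seteqP; split=> // u /= [k _ /p_inj]; lia.
move=> _ [[|k] _ <-] // _; split=> //.
apply/card_eq_II1; exists (p k); apply/seteqP; split=> u /=.
  by move=> [l -> /p_inj[->]].
by move=> ->; exists k.
Qed.

End Sequence.

(** Nonempty vertex sets turn disjointness into injectivity of [R], which makes the family
    infinite. *)
Lemma infinitely_many_disjoint_seq (P : digraph U -> Prop)
    (R : nat -> digraph U) :
  (forall i, P (R i)) -> (forall i, vertices (R i) !=set0) ->
  (forall i j, vertices (R i) `&` vertices (R j) !=set0 -> i = j) ->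
  infinitely_many_disjoint P.
Proof.
move=> PR R0 Rdisj; exists (range R); split.
- move=> Rfin; apply: infinite_nat.
  rewrite (_ : setT = R @^-1` range R).
    apply: finite_preimage Rfin => i j _ _ Rij; apply: Rdisj.
    by rewrite Rij setIid.
  by apply/seteqP; split=> // i _; exists i.
- by move=> _ [i _ <-].
- by move=> _ _ [i _ <-] [j _ <-] /Rdisj ->.
Qed.

End Digraphs.

(** * The chain of grids, its rows and its columns *)

Definition right_step (u : nat * nat * nat) : nat * nat * nat :=
  let: (n, x, y) := u in if x < n then (n, x.+1, y) else (n.+1, 0, y).

Definition transpose (u : nat * nat * nat) : nat * nat * nat :=
  let: (n, x, y) := u in (n, y, x).

Definition in_square (u : nat * nat * nat) : Prop :=
  let: (n, x, y) := u in x <= n /\ y <= n.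

(* The n-th square is an (n+1) x (n+1) grid whose points (n, x, y) have column
   [x] and row [y]. Rows are directed to the right and lead on to the next
   square; columns are directed downwards and come from the next square, so
   that [transpose] reverses all arcs. *)
Definition grid_arc (u v : nat * nat * nat) : Prop :=
  [/\ in_square u, in_square v &
      v = right_step u \/ transpose u = right_step (transpose v)].

Lemma right_step_neq u : right_step u <> u.
Proof. by move: u => [[n x] y] /=; case: ifP => _ []; lia. Qed.

Lemma transposeK : involutive transpose.
Proof. by move=> [[]]. Qed.

Lemma grid_arc_loopless u : ~ grid_arc u u.
Proof. by move=> [_ _ [|]] /esym /right_step_neq. Qed.

Definition grid_digraph : digraph (nat * nat * nat) :=
  @Digraph _ in_square grid_arc
    (fun u v uv => let: And3 Du _ _ := uv in Du)
    (fun u v uv => let: And3 _ Dv _ := uv in Dv)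
    grid_arc_loopless.

Lemma in_square_transpose u : in_square (transpose u) <-> in_square u.
Proof. by move: u => [[n x] y] /=; split=> [] []. Qed.

Lemma grid_arc_transpose u v :
  grid_arc u v -> grid_arc (transpose v) (transpose u).
Proof.
by move=> [Du Dv uv]; split; rewrite ?in_square_transpose ?transposeK//; tauto.
Qed.

(** Row [i] starts in the [i]-th square, the first one large enough to contain it. *)
Definition row (i k : nat) : nat * nat * nat := iter k right_step (i, 0, i).

Lemma row_in_square i k : in_square (row i k).
Proof.
elim: k => //= k; case: (row i k) => [[n x] y] /= [xn yn].
by case: ifP => /=; lia.
Qed.

Lemma row_index i k : (row i k).2 = i.
Proof. by elim: k => //= k; case: (row i k) => [[n x] y] /=; case: ifP. Qed.

Lemma row_arc i k : grid_arc (row i k) (row i k.+1).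
Proof. by split; [exact: row_in_square|exact: row_in_square|left]. Qed.

(** Increases along rows, also between squares: [n * n + n < n.+1 * n.+1]. *)
Definition row_rank (u : nat * nat * nat) : nat := u.1.1 * u.1.1 + u.1.2.

Lemma row_inj i : injective (row i).
Proof.
have rank_mono : {homo row_rank \o row i : k l / k < l}.
  apply: homo_ltn; first exact: ltn_trans.
  move=> k /=; have := row_in_square i k.
  case: (row i k) => [[n x] y] /= [xn _].
  by rewrite /row_rank; case: ifP => /= _; nia.
move=> k l kl; have := congr1 row_rank kl.
have := rank_mono k l; have := rank_mono l k => /=; lia.
Qed.

Lemma column_inj i : injective (transpose \o row i).
Proof. exact: inj_comp (inv_inj transposeK) (@row_inj i). Qed.

Lemma grid_rays : infinitely_many_disjoint (ray_of grid_digraph).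
Proof.
apply: (@infinitely_many_disjoint_seq _ _ (fun i => sequence_digraph (@row_inj i))).
- move=> i; split; last exact: sequence_is_ray.
  split=> [_ [k _ <-]|_ _ [k -> ->]]; first exact: row_in_square.
  exact: row_arc.
- by move=> i; exists (row i 0), 0.
- by move=> i j [_ [[k _ <-] [l _ kl]]]; rewrite -(row_index i k) -kl row_index.
Qed.

Lemma grid_antirays : infinitely_many_disjoint (antiray_of grid_digraph).
Proof.
apply: (@infinitely_many_disjoint_seq _ _
  (fun i => rev_digraph (sequence_digraph (@column_inj i)))).
- move=> i; split; last by apply: is_antiray_rev; exact: sequence_is_ray.
  split=> [_ [k _ <-]|_ _ [k -> ->]].
    by apply/in_square_transpose; exact: row_in_square.
  by apply: grid_arc_transpose; exact: row_arc.
- by move=> i; exists (transpose (row i 0)), 0.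
- move=> i j [_ [[k _ <-] [l _ /(inv_inj transposeK) kl]]].
  by rewrite -(row_index i k) -kl row_index.
Qed.

(** * Crossings of a square *)

Lemma square_unbounded (p : nat -> nat * nat * nat) (N : nat) :
  injective p -> (forall k, in_square (p k)) -> exists k, N < (p k).1.1.
Proof.
move=> p_inj p_sq; apply: contrapT => /forallNP pN.
(* Within the squares up to [N] all coordinates are at most [N], so [inord] loses nothing and the
   pigeonhole principle applies. *)
pose code (u : nat * nat * nat) : 'I_N.+1 * 'I_N.+1 * 'I_N.+1 :=
  (inord u.1.1, inord u.1.2, inord u.2).
pose T : finType := ('I_N.+1 * 'I_N.+1 * 'I_N.+1)%type.
have /leq_card : injective (fun k : 'I_#|T|.+1 => code (p k)).
  move=> k l [].
  have := pN k; have := p_sq k; have := pN l; have := p_sq l.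
  have := p_inj k l.
  case: (p k) => [[n x] y]; case: (p l) => [[n' x'] y'] /=.
  move=> klE ? ? ? ? /(congr1 (@nat_of_ord _)) + /(congr1 (@nat_of_ord _)) +
    /(congr1 (@nat_of_ord _)).
  rewrite !inordK; try lia.
  by move=> nn xx yy; apply: val_inj => /=; apply: klE; rewrite nn xx yy.
by rewrite card_ord ltnn.
Qed.

(* The sequence cannot enter the [N]-th square through the columns before it has
   gone beyond that square, so it enters on the left and leaves on the right.
   The value [f x] is the row in which it first reaches column [x]. *)
Lemma forward_crossing (p : nat -> nat * nat * nat) (N : nat) :
  (forall k, grid_arc (p k) (p k.+1)) -> (p 0).1.1 < N ->
  (exists k, N < (p k).1.1) ->
  exists f : nat -> nat,
    [/\ forall x, x <= N -> f x <= N,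
        forall x x', x <= x' -> x' <= N -> f x' <= f x &
        forall x, x <= N -> exists k, p k = (N, x, f x)].
Proof.
move=> p_arc p0 pN.
(* The lower bound [(p m).2] on [f] keeps [f] antitone when the next column is given the current row
   as its value. *)
have inv m : (forall k, k <= m -> (p k).1.1 <= N) -> (p m).1.1 = N ->
    exists f : nat -> nat,
    [/\ forall x, x <= (p m).1.2 -> (p m).2 <= f x <= N,
        forall x x', x <= x' -> x' <= (p m).1.2 -> f x' <= f x &
        forall x, x <= (p m).1.2 -> exists k, p k = (N, x, f x)].
  elim: m => [|m IH] mN pmN; first by lia.
  have {IH} := IH (fun k km => mN k (leqW km)).
  have := mN m (leqnSn m); have := p_arc m.
  case pm: (p m) => [[n x] y]; case pm1: (p m.+1) => [[n' x'] y'] /=.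
  move: pmN; rewrite pm1 /= => ?; subst n'.
  move=> [/= [xn yn] [x'n y'n] steps] nN.
  case: steps; case: ifP => // cmp [] ? ? ?; subst.
  - move=> /(_ erefl)[f [f_range f_anti f_visit]].
    exists (fun z => if z <= x then f z else y); split=> [z zx|z z' zz' zx|z zx].
    + by case: ifP => [/f_range//|_]; rewrite leqnn.
    + case: ifP => z'x; first by rewrite (leq_trans zz' z'x) f_anti.
      by case: ifP => [/f_range/andP[]|].
    + case: ifP => [/f_visit//|zx']; exists m.+1.
      by rewrite pm1 (_ : z = x.+1)//; lia.
  - move=> _; exists (fun=> y); split=> [z|//|z]; first lia.
    by rewrite leqn0 => /eqP ->; exists m.+1.
  - move=> /(_ erefl)[f [f_range f_anti f_visit]].
    by exists f; split=> // z /f_range; lia.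
  - lia.
(* The first arc going beyond the square is a row arc out of column [N], so by then [f] covers every
   column. *)
case: (ex_minnP pN) => -[|m] pmN m_min; first by lia.
have mN k : k <= m -> (p k).1.1 <= N.
  by move=> km; rewrite leqNgt; apply/negP => /m_min; lia.
have := inv m mN; have := mN m (leqnn m); have := p_arc m; move: pmN.
case pm: (p m) => [[n x] y]; case pm1: (p m.+1) => [[n' x'] y'] /=.
move=> Nn' [/= [xn yn] [x'n y'n] steps] nN.
case: steps; case: ifP => // cmp [] ? ? ?; subst; try lia.
have nN' : n = N by lia.
subst; have xN : x = N by lia.
subst; move=> /(_ erefl) [f [f_range f_anti f_visit]].
by exists f; split=> // z /f_range /andP[].
Qed.

(** A discrete intermediate value argument: inside the square, increasing the index moves [q] one
    column left, where [f] is no smaller, or one row up, so [q] cannot jump over the graph of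
    [f]. *)
Lemma backward_meets_antitone (q : nat -> nat * nat * nat) (N : nat)
    (f : nat -> nat) :
  (forall k, grid_arc (q k.+1) (q k)) -> (q 0).1.1 < N ->
  (exists k, N < (q k).1.1) ->
  (forall x, x <= N -> f x <= N) ->
  (forall x x', x <= x' -> x' <= N -> f x' <= f x) ->
  exists k x, x <= N /\ q k = (N, x, f x).
Proof.
move=> q_arc q0 qN f_range f_anti; apply: contrapT => nmeet.
have miss k x y : x <= N -> q k = (N, x, y) -> y <> f x.
  by move=> xN qk yf; apply: nmeet; exists k, x; rewrite qk yf.
(* Read backwards, [q] enters the square in row 0 and, as [f] is antitone,
   stays strictly below its graph. *)
have inv m : (forall k, k <= m -> (q k).1.1 <= N) -> (q m).1.1 = N ->
    (q m).2 < f (q m).1.2.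
  elim: m => [|m IH] mN qmN; first by lia.
  have {IH} := IH (fun k km => mN k (leqW km)).
  have := mN m (leqnSn m); have := q_arc m; have := miss m.+1.
  case qm: (q m) => [[n x] y]; case qm1: (q m.+1) => [[n' x'] y'] /=.
  move: qmN; rewrite qm1 /= => ?; subst n'.
  move=> missm [/= [x'n y'n] [xn yn] steps] nN.
  have := missm x' y' x'n erefl.
  case: steps; case: ifP => // cmp [] ? ? ?; subst; try lia.
  by have := f_anti x' x'.+1; lia.
(* [q] first gets beyond the square from row [N], which is not strictly below [f]. *)
case: (ex_minnP qN) => -[|m] qmN m_min; first by lia.
have mN k : k <= m -> (q k).1.1 <= N.
  by move=> km; rewrite leqNgt; apply/negP => /m_min; lia.
have := inv m mN; have := mN m (leqnn m); have := q_arc m; move: qmN.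
case qm: (q m) => [[n x] y]; case qm1: (q m.+1) => [[n' x'] y'] /=.
move=> Nn' [/= [x'n y'n] [xn yn] steps] nN.
case: steps; case: ifP => // cmp [] ? ? ?; subst; try lia.
by have := f_range x; lia.
Qed.

Theorem theorem4p1 :
  exists (U : Type) (D : digraph U),
    [/\ infinitely_many_disjoint (ray_of D),
        infinitely_many_disjoint (antiray_of D) &
        forall R A : digraph U, ray_of D R -> antiray_of D A ->
          vertices R `&` vertices A !=set0].
Proof.
exists (nat * nat * nat)%type, grid_digraph.
split; [exact: grid_rays|exact: grid_antirays|].
move=> R A [[RD Rarc] /ray_sequence[p [p_inj Rp p_arc]]].
move=> [[AD Aarc] /is_ray_rev/ray_sequence[q [q_inj Aq q_arc]]].
(* Both sequences start before the [N]-th square, so both have to cross it completely. *)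
pose N := (maxn (p 0).1.1 (q 0).1.1).+1.
have pN := square_unbounded N p_inj (fun k => RD _ (Rp k)).
have qN := square_unbounded N q_inj (fun k => AD _ (Aq k)).
have [||f [f_range f_anti f_visit]] := @forward_crossing p N _ _ pN.
- by move=> k; apply: Rarc.
- by rewrite ltnS leq_maxl.
have [||k [x [xN qk]]] := @backward_meets_antitone q N f _ _ qN f_range f_anti.
- by move=> k; apply: Aarc; exact: q_arc.
- by rewrite ltnS leq_maxr.
have [l pl] := f_visit x xN.
by exists (p l); split=> //; rewrite pl -qk; exact: Aq.
Qed.
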